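(* The solution $\Delta e^*$ returned by the Greedy Oracle (the algorithm described in the context) is an optimal solution of the problem $$\min_{\Delta e\in\mathcal Y_e}\ \sum_{t\in\mathcal T}f_t(\Delta e_t).$$
   Context: Problem. Let $\mathcal T=\{1,\dots,T\}$ and fix a scenario $\omega$ with prices $\lambda_t:=\lambda^{\mathrm{DA}}_{t,\omega}$, a committed schedule $p^{\mathrm{DA}}_t$, loads $p_t^\ell$, and a fixed PV profile $p_t^{\mathrm{PV}}=p_t^{\mathrm{PV},*}(\omega)$. Constants: $c^{\mathrm{PV}}>0$, $c^{\mathrm{ES}}\ge0$, $\eta^{\mathrm{ch}},\eta^{\mathrm{dis}}\in(0,1]$, with $\lambda_t>c^{\mathrm{PV}}$ and $0<\kappa\le\min_{t\neq t'}\{|\lambda_t-\lambda_{t'}|/2,\ \lambda_t-c^{\mathrm{PV}}\}$. Put $\lambda^\pm_t=\lambda_t\pm\kappa$ and $$\begin{aligned}f_t(x)=\max\bigl\{&\eta^{\mathrm{dis}}(\lambda_t^+-c^{\mathrm{ES}})x+b_t^+,\ (\lambda_t^+/\eta^{\mathrm{ch}})x+b_t^+,\\&\eta^{\mathrm{dis}}(\lambda_t^--c^{\mathrm{ES}})x+b_t^-,\ (\lambda_t^-/\eta^{\mathrm{ch}})x+b_t^-\bigr\},\end{aligned}$$ with $b_t^\pm=(c^{\mathrm{PV}}-\lambda_t^\pm)p_t^{\mathrm{PV}}+\lambda_t^\pm(p_t^{\mathrm{DA}}+p_t^\ell)$. For given $\underline e\le e_0\le\bar e$, $\mathcal Y_e=\{\Delta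 e\in\mathbb R^T:\ \underline e-e_0\le\sum_{\tau=1}^t\Delta e_\tau\le\bar e-e_0\ \forall t\in\mathcal T\setminus\{T\},\ \sum_{\tau=1}^T\Delta e_\tau=0\}$. Notation. $\bar e_t=\bar e$, $\underline e_t=\underline e$ for $t\in\mathcal T\setminus\{T\}$, and $\bar e_0=\underline e_0=\bar e_T=\underline e_T=e_0$. $[x]_+=\max\{x,0\}$. $a_t(x)$ is the left derivative of $f_t$ at $x$. $\hat\alpha_{t,1},\dots,\hat\alpha_{t,4}$ are the slopes of the four affine pieces of $f_t$. $\mathcal A^{(0)}$ is the list of all $\hat\alpha_{t,i}$ ($t\in\mathcal T$, $i\in\{1,\dots,4\}$), sorted in decreasing order with ties broken lexicographically; entries are identified by their index $(t,i)$. For an iterate $\Delta e^{(k)}$, $e_t^{(k)}=e_0+\sum_{s\le t}\Delta e_s^{(k)}$. ''Remove times $I$'' means $\mathcal A^{(k+1)}=\mathcal A^{(k)}\setminus\{\hat\alpha_{s,i}:s\in I,\ i=1,\dots,4\}$. Conventions: a minimum over the empty set is $+\infty$, and a maximum of the nonnegative quantities $[\cdot]_+$ over the empty set is $0$. Greedy Oracle. Initialize $\Delta e_t^{(0)}=\bar e_t-\underline e_{t-1}$ for $t\in\mathcal T$ and $k=0$. While $\mathcal A^{(k)}\ne\varnothing$, let $\hat\alpha_{t,\iota}$ be its first element and perform exactly one of the following; components of $\Delta e$ and the list $\mathcal A$ not mentioned remain unchanged. (A) If $a_t(\Delta e_t^{(k)})<\hat\alpha_{t,\iota}$: remove $\hat\alpha_{t,\iota}$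 from $\mathcal A^{(k)}$. (B) Else if $a_t(\Delta e_t^{(k)})\le0$: if $\Delta e^{(k)}\in\mathcal Y_e$, return $\Delta e^{(k)}$. Otherwise let $\tau=\min\{j:e_j^{(k)}-\bar e_j>0\}$ and let $\hat\alpha_{\tau',i}$ be the first element of $\mathcal A^{(k)}$ with $\tau'\le\tau$. Set $\delta_1=\sup\{\delta:a_{\tau'}(\Delta e_{\tau'}^{(k)}-\delta)\ge\hat\alpha_{\tau',i}\}$, $\delta_2=\min_{\tau'\le s<\tau}\{e_s^{(k)}-\underline e_s\}$, $\delta_3=e_\tau^{(k)}-\bar e_\tau$, $\delta^*=\min\{\delta_1,\delta_2,\delta_3\}$ and $\Delta e_{\tau'}^{(k+1)}=\Delta e_{\tau'}^{(k)}-\delta^*$. If $\delta^*=\delta_1$, remove $\hat\alpha_{\tau',i}$. Else if $\delta^*=\delta_2$, let $\tau^*=\max\{s:\tau'\le s<\tau,\ e_s^{(k)}-\underline e_s=\delta_2\}$ and remove times $\{1,\dots,\tau^*\}$. (C) Else: set $\delta_1=\sup\{\delta:a_t(\Delta e_t^{(k)}-\delta)\ge\hat\alpha_{t,\iota}\}$, $\delta_2=\min_{t\le\tau\le T}\{e_\tau^{(k)}-\underline e_\tau\}-\max_{1\le\tau\le t-1}[e_\tau^{(k)}-\bar e_\tau]_+$, $\delta^*=\min\{\delta_1,\delta_2\}$ and $\Delta e_t^{(k+1)}=\Delta e_t^{(k)}-\delta^*$. If $\delta^*=\delta_1$, remove $\hat\alpha_{t,\iota}$. Else if $\min_{t\le\tau\le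 T}\{e_\tau^{(k)}-\underline e_\tau\}=\delta_2$, let $\tau=\max\{s:t\le s\le T,\ e_s^{(k)}-\underline e_s=\delta_2\}$ and remove times $\{1,\dots,\tau\}$. Else let $\tilde\delta=\max_{1\le\tau\le t-1}\{e_\tau^{(k)}-\bar e_\tau\}$, $\delta'=\min_{t\le\tau\le T}\{e_\tau^{(k)}-\underline e_\tau\}$, $\tau_1=\min\{\tau\le t-1:e_\tau^{(k)}-\bar e_\tau=\tilde\delta\}$ and $\tau_2=\max\{\tau\ge t:e_\tau^{(k)}-\underline e_\tau=\delta'\}$, and remove times $\{\tau_1+1,\dots,\tau_2\}$. Then increase $k$ by one. When $\mathcal A^{(k)}=\varnothing$, return $\Delta e^{(k)}$. *)

(* Defs.v *)
From HB Require Import structures.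
From mathcomp Require Import all_boot all_order all_algebra.
From mathcomp Require Import boolp classical_sets reals ereal topology normedtype.

Set Implicit Arguments.
Unset Strict Implicit.
Unset Printing Implicit Defensive.

Import Order.TTheory GRing.Theory Num.Theory.
Import numFieldNormedType.Exports.

Local Open Scope classical_set_scope.
Local Open Scope ring_scope.

(* The time periods 1, ..., T are the elements of 'I_T, so that t : 'I_T      *)
(* stands for period t.+1.  Stored energies and their bounds are indexed by   *)
(* nat, with n = 0, ..., T, so that n = 0 is the initial state and the state  *)
(* at the end of the period t : 'I_T has index t.+1.                          *)

Record problem (R : realType) (T : nat) := Problem {
  price : 'I_T -> R;    (* lambda^DA_{t, omega} for the fixed scenario omega *)
  pDA : 'I_T -> R;
  pload : 'I_T -> R;
  pPV : 'I_T -> R;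
  cPV : R;
  cES : R;
  eta_ch : R;
  eta_dis : R;
  kappa : R;
  e_init : R;
  e_min : R;
  e_max : R }.

Section Cost.
Context (R : realType) (T : nat) (P : problem R T).

Definition price_up (t : 'I_T) : R := price P t + kappa P.
Definition price_dn (t : 'I_T) : R := price P t - kappa P.

Definition intercept (l : R) (t : 'I_T) : R :=
  (cPV P - l) * pPV P t + l * (pDA P t + pload P t).

Definition slope_dis (l : R) : R := eta_dis P * (l - cES P).
Definition slope_ch (l : R) : R := l / eta_ch P.

Definition cost (t : 'I_T) (x : R) : R :=
  let lp := price_up t in
  let lm := price_dn t in
  Num.max
    (Num.max (slope_dis lp * x + intercept lp t)
             (slope_ch lp * x + intercept lp t))
    (Num.max (slope_dis lm * x + intercept lm t)
             (slope_ch lm * x + intercept lm t)).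

(* Slopes of the four pieces of [cost t], in the order in which they occur.   *)
Definition slope (t : 'I_T) (i : 'I_4) : R :=
  tnth [tuple slope_dis (price_up t); slope_ch (price_up t);
              slope_dis (price_dn t); slope_ch (price_dn t)] i.

Definition left_derivative (f : R -> R) (x : R) : R :=
  lim ((f y - f x) / (y - x) @[y --> x^'-]).

Definition feasible (d : 'rV[R]_T) : bool :=
  [forall t : 'I_T, (t.+1 != T) ==>
     (e_min P - e_init P <= \sum_(s < T | (s <= t)%N) d 0 s
                         <= e_max P - e_init P)]
  && (\sum_(s < T) d 0 s == 0).

Definition total_cost (d : 'rV[R]_T) : R := \sum_(t < T) cost t (d 0 t).

Definition optimal (d : 'rV[R]_T) : Prop :=
  feasible d /\ (forall d', feasible d' -> total_cost d <= total_cost d').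

End Cost.

Section GreedyOracle.
Context (R : realType) (T : nat) (P : problem R T).

Local Notation vec := 'rV[R]_T.
Local Notation piece := ('I_T * 'I_4)%type.

Definition e_up (n : nat) : R :=
  if (n == 0%N) || (n == T) then e_init P else e_max P.
Definition e_lo (n : nat) : R :=
  if (n == 0%N) || (n == T) then e_init P else e_min P.

Definition energy (d : vec) (n : nat) : R :=
  e_init P + \sum_(s < T | (s < n)%N) d 0 s.

Definition excess (d : vec) (t : 'I_T) : R := energy d t.+1 - e_up t.+1.
Definition slack (d : vec) (t : 'I_T) : R := energy d t.+1 - e_lo t.+1.

Definition greedy_init : vec := \row_(t < T) (e_up t.+1 - e_lo t).

Definition piece_before (p q : piece) : bool :=
  (slope P q.1 q.2 < slope P p.1 p.2) ||
  ((slope P p.1 p.2 == slope P q.1 q.2) &&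
   ((p.1 < q.1)%N || ((p.1 == q.1) && (p.2 <= q.2)%N))).

Definition sorted_pieces : seq piece := sort piece_before (enum {: piece}).

Definition decrease (d : vec) (t : 'I_T) (delta : R) : vec :=
  \row_s (if s == t then d 0 s - delta else d 0 s).

(* The step length up to which the piece (t, i) supports the decrease of      *)
(* [d 0 t]; it is +oo when [slope P t i] is the smallest slope of [cost P t]. *)
Definition piece_step (d : vec) (t : 'I_T) (i : 'I_4) : \bar R :=
  ereal_sup [set delta%:E | delta in
    [set delta | slope P t i <= left_derivative (cost P t) (d 0 t - delta)]].

(* The default t0 is only a placeholder for an empty Q; in every use below,   *)
(* Q is satisfied by some period.                                             *)
Definition first_time (t0 : 'I_T) (Q : pred 'I_T) : 'I_T :=
  head t0 [seq s <- enum 'I_T | Q s].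
Definition last_time (t0 : 'I_T) (Q : pred 'I_T) : 'I_T :=
  last t0 [seq s <- enum 'I_T | Q s].

Definition remove_times (I : pred 'I_T) (A : seq piece) : seq piece :=
  [seq p : piece <- A | ~~ I p.1].

(* [Stuck]: an instruction refers to the minimum of an empty set of periods   *)
(* or to the first element of an empty list.                                  *)
Inductive outcome :=
  | Return of vec
  | Continue of vec & seq piece
  | Stuck.

Definition repair_step (d : vec) (A : seq piece) : outcome :=
  if [seq j <- enum 'I_T | 0 < excess d j] is tau :: _ then
    if [seq p : piece <- A | (p.1 <= tau)%N] is (tau', i) :: _ then
      let delta1 := piece_step d tau' i in
      let delta2 := \big[Order.min/+oo%E]_(s < T | (tau' <= s < tau)%N)
                      (slack d s)%:E in
      let delta3 := (excess d tau)%:E in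
      let delta := Order.min delta1 (Order.min delta2 delta3) in
      let d' := decrease d tau' (fine delta) in
      if delta == delta1 then Continue d' (rem (tau', i) A)
      else if delta == delta2 then
        let tau_last := last_time tau'
          [pred s : 'I_T | (tau' <= s < tau)%N && ((slack d s)%:E == delta2)] in
        Continue d' (remove_times [pred s : 'I_T | (s <= tau_last)%N] A)
      else Continue d' A
    else Stuck
  else Stuck.

Definition descent_step (d : vec) (A : seq piece) (t : 'I_T) (i : 'I_4) :
    outcome :=
  let delta1 := piece_step d t i in
  let min_slack := \big[Order.min/+oo%E]_(s < T | (t <= s)%N) (slack d s)%:E in
  let delta2 := (min_slack -
    (\big[Num.max/0]_(s < T | (s < t)%N) Num.max (excess d s) 0)%:E)%E in
  let delta := Order.min delta1 delta2 in
  let d' := decrease d t (fine delta) in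
  if delta == delta1 then Continue d' (rem (t, i) A)
  else if min_slack == delta2 then
    let tau := last_time t
      [pred s : 'I_T | (t <= s)%N && ((slack d s)%:E == delta2)] in
    Continue d' (remove_times [pred s : 'I_T | (s <= tau)%N] A)
  else
    let max_excess :=
      \big[Order.max/-oo%E]_(s < T | (s < t)%N) (excess d s)%:E in
    let tau1 := first_time t
      [pred s : 'I_T | (s < t)%N && ((excess d s)%:E == max_excess)] in
    let tau2 := last_time t
      [pred s : 'I_T | (t <= s)%N && ((slack d s)%:E == min_slack)] in
    Continue d' (remove_times [pred s : 'I_T | (tau1 < s <= tau2)%N] A).

Definition greedy_step (d : vec) (A : seq piece) : outcome :=
  if A is (t, i) :: _ then
    let a := left_derivative (cost P t) (d 0 t) in
    if a < slope P t i then Continue d (rem (t, i) A)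
    else if a <= 0 then
      if feasible P d then Return d else repair_step d A
    else descent_step d A t i
  else Return d.

Inductive returns_from (d : vec) (A : seq piece) (res : vec) : Prop :=
  | returns_now of greedy_step d A = Return res
  | returns_later d' A' of
      greedy_step d A = Continue d' A' & returns_from d' A' res.

Definition greedy_returns (res : vec) : Prop :=
  returns_from greedy_init sorted_pieces res.

End GreedyOracle.

(* Main.v *)
(* The energy constraints make Y_e the base polytope of a contrapolymatroid: a
   point x dominates some feasible point iff excess at n <= slack at m for all
   n <= m, and the step lengths of the oracle keep this true.

   The invariant is that every feasible z can be replaced, at no extra cost, by
   a feasible z' <= x.  Suppose x_t is lowered by r and z_t is still too large.
   Base exchange lowers z_t to the new bound and raises entries of periods that
   are not frozen, i.e. not yet forced to equal x.  Along the step the slope of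
   f_t is at least the selected slope c, and the entries raised have slope at
   most c, so the cost does not grow.  In (B) the selected slope is maximal only
   among the periods up to tau; since the energy still reaches its upper bound
   after tau, the exchange can be confined to these periods.

   When the oracle stops, x itself is feasible, and it is the only feasible
   point below x. *)

Require Import Defs.
From mathcomp Require Import all_boot all_order all_algebra.
From mathcomp Require Import reals.
From mathcomp Require Import boolp classical_sets ereal topology normedtype.
From mathcomp Require Import lra zify.
Import Order.TTheory GRing.Theory Num.Theory.
Import numFieldNormedType.Exports.
Local Open Scope classical_set_scope.
Local Open Scope ring_scope.

Set Implicit Arguments.
Unset Strict Implicit.
Unset Printing Implicit Defensive.

(** * Left derivatives of a maximum of finitely many affine functions *)

Section MaxAffine.
Context (R : realType) (I : finType) (s b : I -> R) (f : R -> R).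
Context (f_ge : forall x i, s i * x + b i <= f x).
Context (f_attained : forall x, exists i, f x = s i * x + b i).

Local Notation a := (left_derivative f).

(** Among the pieces active at [x], one of least slope stays on top just to the left of [x], so the
    difference quotient is constant there. *)
Lemma left_derivative_piece x : exists i,
  [/\ a x = s i, f x = s i * x + b i
    & exists2 y, y < x & f y = s i * y + b i].
Proof.
have [i0 /eqP act0] := f_attained x.
case: (@arg_minP _ _ _ i0 [pred i | f x == s i * x + b i] s act0) => i /= /eqP fxi s_min.
have near_i : \forall y \near x^'-, f y = s i * y + b i.
  have H : forall j, \forall y \near x^'-, s j * y + b j <= s i * y + b i.
    move=> j; have [/s_min sij|ne] := boolP (f x == s j * x + b j).
      near=> y; have fxj : s j * x + b j <= s i * x + b i by rewrite -fxi f_ge.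
      have : y < x by near: y; exact: nbhs_left_lt.
      by move=> yx; nra.
    have gap : 0 < f x - (s j * x + b j).
      by rewrite subr_gt0 lt_neqAle f_ge eq_sym ne.
    set g := f x - _ in gap.
    (* An inactive piece is [g] too low at [x] and cannot catch up within distance [g / c]. *)
    pose c := `|s i - s j| + 1.
    have c_gt0 : 0 < c by rewrite /c ltr_wpDl.
    near=> y.
    have yx : y < x by near: y; exact: nbhs_left_lt.
    have : x - g / c < y.
      near: y; apply: nbhs_left_gt; rewrite ltrBlDr ltrDl; exact: divr_gt0.
    rewrite ltrBlDr -ltrBlDl ltr_pdivlMr// => h.
    have h2 : (s i - s j) * (x - y) <= c * (x - y).
      apply: ler_wpM2r; first lra.
      by rewrite /c; apply: (le_trans (ler_norm _)); rewrite lerDl.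
    rewrite /g fxi in h; nra.
  apply: filterS (filter_forall _ H) => y Hy; have [j fyj] := f_attained y.
  by apply/eqP; rewrite eq_le f_ge andbT fyj Hy.
have aE : a x = s i.
  rewrite /left_derivative; apply: cvg_lim => //; apply: cvg_near_cst.
  near=> y.
  have yx : y < x by near: y; exact: nbhs_left_lt.
  have -> : f y = s i * y + b i by near: y.
  rewrite fxi opprD addrACA subrr addr0 -mulrBr mulfK // subr_eq0.
  by rewrite lt_eqF.
exists i; split => //.
have : \forall y \near x^'-, y < x /\ f y = s i * y + b i.
  near=> y; split; last by near: y.
  by near: y; exact: nbhs_left_lt.
by move=> /filter_ex [y [yx fy]]; exists y.
Unshelve. all: by end_near.
Qed.

Lemma left_derivative_subgradient x y : f x + a x * (y - x) <= f y.
Proof.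
have [i [-> -> _]] := left_derivative_piece x.
by apply: le_trans (f_ge y i); lra.
Qed.

Lemma left_derivative_mono x y : x <= y -> a x <= a y.
Proof.
rewrite le_eqVlt => /predU1P[-> //|xy].
have := left_derivative_subgradient x y.
have := left_derivative_subgradient y x.
by nra.
Qed.

(** The piece giving the slope at [x] is active at some [y < x]; at the midpoint, the subgradient
    inequality towards [y] forces a slope at least as large. *)
Lemma left_derivative_left_continuous x : exists2 u, u < x & a x <= a u.
Proof.
have [i [aE fx [y yx fy]]] := left_derivative_piece x.
exists ((x + y) / 2); first by lra.
have := left_derivative_subgradient ((x + y) / 2) y.
have := f_ge ((x + y) / 2) i.
rewrite aE fy => h1 h2.
have : 0 <= (a ((x + y) / 2) - s i) * ((x - y) / 2) by lra.
by rewrite pmulr_lge0 ?subr_ge0//; lra.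
Qed.

Lemma increase_le_left_derivative x y z : y <= z -> z <= x ->
  f z - f y <= a x * (z - y).
Proof.
move=> yz zx; have := left_derivative_subgradient z y.
have := left_derivative_mono zx; nra.
Qed.

(** The slope bound may fail at [p] itself, so the estimate starts from a point [u] slightly right
    of [y], with an error proportional to [u - y]. *)
Lemma increase_ge_left_derivative p y z c :
  (forall u, p < u -> c <= a u) -> p <= y -> y <= z -> c * (z - y) <= f z - f y.
Proof.
move=> c_le py; rewrite le_eqVlt => /predU1P[<-|yz]; first by lra.
have step u : y < u -> u < z ->
    c * (z - y) <= f z - f y + (u - y) * (c - a y).
  move=> yu uz; have := c_le u (le_lt_trans py yu).
  have := left_derivative_subgradient u z.
  have := left_derivative_subgradient y u; nra.
apply/ler_addgt0Pr => e e_gt0.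
pose k := `|c - a y| + 1; have k_gt0 : 0 < k by rewrite ltr_wpDl.
pose h := Num.min ((z - y) / 2) (e / k).
have h_gt0 : 0 < h 
  by rewrite lt_min; apply/andP; split; [lra|exact: divr_gt0].
have hz : h <= (z - y) / 2 by rewrite ge_min lexx.
have hk : h * k <= e by rewrite -ler_pdivlMr// ge_min lexx orbT.
have /(_ _ _)/le_trans := step (y + h); apply; [lra|lra|].
rewrite lerD2l addrAC subrr add0r; apply: le_trans hk.
rewrite ler_pM2l//; apply: (le_trans (ler_norm _)); by rewrite lerDl.
Qed.

End MaxAffine.

(** * Energy paths and feasibility *)

Section Storage.
Context (R : realType) (T : nat) (P : problem R T).
Implicit Types (d x z w : 'rV[R]_T) (t s : 'I_T) (n m k : nat).

Definition excess_at x n := energy P x n - e_up P n.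
Definition slack_at x n := energy P x n - e_lo P n.

Definition dominated x z := forall t, x 0 t <= z 0 t.

Lemma energy0 x : energy P x 0 = e_init P.
Proof. by rewrite /energy big_pred0 ?addr0. Qed.

Lemma energyS x t : energy P x t.+1 = energy P x t + x 0 t.
Proof.
rewrite /energy (bigD1 t) ?ltnS//= addrA addrAC; congr (_ + _ + _).
by apply: eq_bigl => s; rewrite ltnS andbC ltn_neqAle.
Qed.

Lemma energyT x : energy P x T = e_init P + \sum_(t < T) x 0 t.
Proof. by congr (_ + _); apply: eq_bigl => s; rewrite ltn_ord. Qed.

Lemma energy_row (E : nat -> R) n : E 0 = e_init P -> (n <= T)%N ->
  energy P (\row_(t < T) (E t.+1 - E t)) n = E n.
Proof.
move=> E0; elim: n => [|n IH] nT; first by rewrite energy0.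
by rewrite (energyS _ (Ordinal nT)) IH 1?ltnW// mxE addrC subrK.
Qed.

Lemma energy_decrease x t r n :
  energy P (decrease x t r) n = energy P x n - (if (t < n)%N then r else 0).
Proof.
rewrite /energy -addrA; congr (_ + _).
have [tn|nt] := ltnP t n; last first.
  rewrite subr0; apply: eq_bigr => s sn; rewrite mxE ifF//.
  by apply/negP => /eqP st; move: sn; rewrite st ltnNge nt.
rewrite (bigD1 t)//= [in RHS](bigD1 t)//= mxE eqxx addrAC; congr (_ + _).
by apply: eq_bigr => s /andP[_ /negPf st]; rewrite mxE st.
Qed.

Lemma energy_sub_mono x z n m : dominated z x -> (n <= m)%N -> (m <= T)%N ->
  energy P z m - energy P z n <= energy P x m - energy P x n.
Proof.
move=> zx; elim: m => [|m IH]; first by rewrite leqn0 => /eqP ->; rewrite !subrr.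
rewrite leq_eqVlt => /predU1P[-> _|nm mT]; first by rewrite !subrr.
have := IH nm (ltnW mT); have := zx (Ordinal mT).
rewrite (energyS x (Ordinal mT)) (energyS z (Ordinal mT)) /=; lra.
Qed.

Lemma energy_sub_tight x z n m t : dominated z x -> (m <= T)%N ->
  energy P x m - energy P x n <= energy P z m - energy P z n ->
  (n <= t < m)%N -> z 0 t = x 0 t.
Proof.
move=> zx mT tight /andP[nt tm].
have := energy_sub_mono zx nt (ltnW (ltn_ord t)).
have := energy_sub_mono zx tm mT.
have := zx t; rewrite (energyS x t) (energyS z t); lra.
Qed.

Lemma feasibleP x :
  reflect (forall n, (n <= T)%N -> e_lo P n <= energy P x n <= e_up P n)
          (feasible P x).
Proof.
have sumE t : \sum_(s < T | (s <= t)%N) x 0 s = energy P x t.+1 - e_init P.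
  by rewrite /energy addrC addKr.
have sumT : \sum_(s < T) x 0 s = energy P x T - e_init P.
  by rewrite energyT addrC addKr.
rewrite /feasible sumT subr_eq0; apply: (iffP andP) => [[/forallP h /eqP hT] n nT|h].
  rewrite /e_lo /e_up; case: (n =P T) => [->|/eqP nNT]; first by rewrite orbT hT lexx.
  case: n => [|n] in nT nNT *; first by rewrite energy0 lexx.
  have := h (Ordinal nT); rewrite nNT sumE /=; lra.
split; last by have := h T (leqnn _); rewrite /e_lo /e_up eqxx orbT -eq_le eq_sym.
apply/forallP => t; apply/implyP => tT; rewrite sumE.
have := h _ (ltn_ord t); rewrite /e_lo /e_up (negPf tT) /=; lra.
Qed.

Lemma feasible_total x : feasible P x -> energy P x T = e_init P.
Proof.
by move=> /feasibleP/(_ T (leqnn _)); rewrite /e_lo /e_up eqxx orbT -eq_le => /eqP.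
Qed.

Lemma feasible_dominated_eq x z : feasible P x -> feasible P z ->
  dominated z x -> z = x.
Proof.
move=> fx fz zx; apply/rowP => t.
apply: (energy_sub_tight zx (leqnn T) (n := 0)); rewrite ?ltn_ord//.
by rewrite !feasible_total// !energy0.
Qed.

(** * The largest feasible point below a given point *)

Fixpoint running_max (u : nat -> R) n : R :=
  if n is m.+1 then Num.max (running_max u m) (u n) else u 0%N.

Lemma running_max_ge u n k : (k <= n)%N -> u k <= running_max u n.
Proof.
elim: n => [|n IH]; first by rewrite leqn0 => /eqP ->.
by rewrite leq_eqVlt le_max => /predU1P[->|/IH ->//]; rewrite lexx orbT.
Qed.

Lemma running_max_attained u n : exists2 k, (k <= n)%N & running_max u n = u k.
Proof.
elim: n => [|n [k kn IH]]; first by exists 0%N.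
rewrite /=; case: leP => _; first by exists n.+1.
by exists k => //; exact: leqW.
Qed.

Lemma excess_at0 x : excess_at x 0 = 0.
Proof. by rewrite /excess_at energy0 subrr. Qed.

(* Reflecting the energy path of x downwards at e_up gives the largest feasible
   point below x. *)
Lemma completion x :
  (forall n m, (n <= m)%N -> (m <= T)%N -> excess_at x n <= slack_at x m) ->
  exists w, [/\ feasible P w, dominated w x &
    forall n k, (k <= n)%N -> (n <= T)%N ->
      (forall j, (j <= n)%N -> excess_at x j <= excess_at x k) ->
      energy P w n = energy P x n - excess_at x k].
Proof.
move=> ex_sl; pose M := running_max (excess_at x).
pose E n := energy P x n - M n.
have E0 : E 0 = e_init P by rewrite /E /M /= excess_at0 subr0 energy0.
exists (\row_(t < T) (E t.+1 - E t)); split.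
- apply/feasibleP => n nT; rewrite energy_row// /E.
  have := running_max_ge (excess_at x) (leqnn n).
  have [k kn] := running_max_attained (excess_at x) n.
  rewrite -/M => Mk; have := ex_sl k n kn nT; rewrite -Mk.
  rewrite /slack_at /excess_at; lra.
- move=> t; rewrite mxE /E energyS.
  have : M t <= M t.+1 by rewrite /M /= le_max lexx.
  lra.
- move=> n k kn nT kmax; rewrite energy_row// /E /M; congr (_ - _).
  apply/eqP; rewrite eq_le running_max_ge// andbT.
  by have [j jn ->] := running_max_attained (excess_at x) n; exact: kmax.
Qed.

(** Slack at [m] minus excess at [n] can only grow from [w] to [x], and is nonnegative for the
    feasible [w]. This is the converse of [completion]. *)
Lemma completable_excess_slack x w n m : feasible P w -> dominated w x ->
  (n <= m)%N -> (m <= T)%N -> excess_at x n <= slack_at x m.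
Proof.
move=> /feasibleP fw wx nm mT; have := energy_sub_mono wx nm mT.
have := fw m mT; have := fw n (leq_trans nm mT).
rewrite /excess_at /slack_at; lra.
Qed.

(** * Base exchange between feasible points *)

Fixpoint running_min (u : nat -> R) n : R :=
  if n is m.+1 then Num.min (running_min u m) (u n) else u 0%N.

Lemma running_min_le u n : running_min u n <= u n.
Proof. by case: n => [|n]//=; rewrite ge_min lexx orbT. Qed.

Lemma running_min_ge0 u n : (forall k, 0 <= u k) -> 0 <= running_min u n.
Proof. by move=> u0; elim: n => [|n IH]//=; rewrite le_min IH u0. Qed.

Lemma running_min_step u n :
  0 <= running_min u n - running_min u n.+1 <= Num.max 0 (u n - u n.+1).
Proof.
have := running_min_le u n; rewrite /=.
case: (lerP (running_min u n) (u n.+1)); case: (lerP 0 (u n - u n.+1)); lra.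
Qed.

Lemma running_min_eq0 u n k : (forall k, 0 <= u k) -> (k <= n)%N -> u k = 0 ->
  running_min u n = 0.
Proof.
move=> u0; elim: n => [|n IH]; first by rewrite leqn0 => /eqP ->.
rewrite leq_eqVlt => /predU1P[->|kn] uk /=.
  by rewrite uk min_r// running_min_ge0.
by rewrite IH// min_l.
Qed.

Lemma pos_part_step (u v : R) :
  Num.max 0 (Num.max 0 u - Num.max 0 v) <= Num.max 0 (u - v).
Proof.
rewrite ge_max le_max lexx /=.
case: (lerP 0 (u - v)); case: (lerP 0 u); case: (lerP 0 v); lra.
Qed.

(* Base exchange between z and w in energy coordinates, with
   D = energy w - energy z.  The path r is a scaled running minimum: of the
   positive part of D before the edge t, of its negative part after it. *)
Lemma exchange_path (D : nat -> R) (t m : nat) e :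
  D 0%N = 0 -> (t < m)%N -> 0 <= D m -> 0 < e -> e <= D t - D t.+1 ->
  exists r : nat -> R,
  [/\ r 0%N = 0, r t.+1 = r t - e,
     forall n, Num.min 0 (D n) <= r n <= Num.max 0 (D n),
     forall n, n != t -> 0 <= r n.+1 - r n <= Num.max 0 (D n.+1 - D n)
   & forall n, (m <= n)%N -> r n = 0].
Proof.
move=> D0 tm Dm e_gt0 eD.
pose pos n := Num.max 0 (D n); pose neg n := Num.max 0 (- D n).
have pos_ge0 n : 0 <= pos n by rewrite le_max lexx.
have neg_ge0 n : 0 <= neg n by rewrite le_max lexx.
pose ul k := pos (t - k)%N; pose ur k := neg (t.+1 + k)%N.
have ul_ge0 k : 0 <= ul k by exact: pos_ge0.
have ur_ge0 k : 0 <= ur k by exact: neg_ge0.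
pose q n := if (n <= t)%N then running_min ul (t - n)
            else - running_min ur (n - t.+1).
(* The path [q] drops by exactly [phi] across the edge [t]; scaling by [e / phi <= 1] makes the drop
   [e]. *)
pose phi := pos t + neg t.+1.
have phi_ge : e <= phi.
  have : D t <= pos t by rewrite le_max lexx orbT.
  have : - D t.+1 <= neg t.+1 by rewrite le_max lexx orbT.
  rewrite /phi; lra.
have phi_gt0 : 0 < phi by lra.
pose th := e / phi.
have th_ge0 : 0 <= th by rewrite divr_ge0// ltW.
have th_le1 : th <= 1 by rewrite ler_pdivrMr ?mul1r.
have q_bounds n : Num.min 0 (D n) <= q n <= Num.max 0 (D n).
  rewrite /q; have [nt|tn] := leqP n t.
    have := running_min_le ul (t - n); rewrite {2}/ul subKn// => ->.
    rewrite andbT; apply: (@le_trans _ _ 0); first by rewrite ge_min lexx.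
    exact: running_min_ge0.
  have := running_min_le ur (n - t.+1); rewrite {2}/ur subnKC// /neg => h.
  have h0 : 0 <= running_min ur (n - t.+1) by exact: running_min_ge0.
  by move: h; case: (lerP 0 (D n)) => Dn; case: (lerP 0 (- D n)) => ?; lra.
have q_step n : n != t -> 0 <= q n.+1 - q n <= Num.max 0 (D n.+1 - D n).
  rewrite /q; case: ltngtP => // [nt|tn] _.
    have -> : (t - n = (t - n.+1).+1)%N by lia.
    have /andP[-> h] := running_min_step ul (t - n.+1); apply: le_trans h _.
    have -> : ul (t - n.+1)%N = pos n.+1 by rewrite /ul subKn.
    have -> : ul (t - n.+1).+1 = pos n by rewrite /ul; congr pos; lia.
    exact: pos_part_step.
  have -> : (n.+1 - t.+1 = (n - t.+1).+1)%N by lia.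
  rewrite opprK addrC.
  have /andP[-> h] := running_min_step ur (n - t.+1); apply: le_trans h _.
  have -> : ur (n - t.+1)%N = neg n by rewrite /ur subnKC.
  have -> : ur (n - t.+1).+1 = neg n.+1 by rewrite /ur; congr neg; lia.
  by apply: le_trans (pos_part_step _ _) _; rewrite opprK addrC.
have qt : q t.+1 = q t - phi.
  rewrite /q leqnn ltnn !subnn /= /ul /ur subn0 addn0 /phi; lra.
exists (fun n => th * q n); split.
- by have := q_bounds 0%N; rewrite D0 minxx maxxx -eq_le => /eqP <-; rewrite mulr0.
- by rewrite qt mulrBr /th divfK// gt_eqF.
- by move=> n; have := q_bounds n; case: (lerP 0 (D n)) => _ qn; nra.
- move=> n nt; have := q_step n nt; rewrite -mulrBr.
  by move: (Num.max _ _) => M qM; nra.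
(* Since [D m] is nonnegative, its negative part is 0, and the running minimum stays 0 from [m]
   on. *)
- move=> n mn; rewrite /q leqNgt (leq_trans tm mn)/= (running_min_eq0 (k := m - t.+1)).
  + by rewrite oppr0 mulr0.
  + exact: ur_ge0.
  + exact: leq_sub2r.
  + by rewrite /ur subnKC// /neg max_l// oppr_le0.
Qed.

(** Adding the path of [exchange_path] to the energies of [z] keeps them between those of [z] and
    [w], hence within the bounds. The comparison at [m] confines all changes to periods before
    [m]. *)
Lemma base_exchange z w t m e : feasible P z -> feasible P w ->
  (t < m)%N -> (m <= T)%N -> energy P z m <= energy P w m ->
  0 < e -> w 0 t <= z 0 t - e ->
  exists z', [/\ feasible P z', z' 0 t = z 0 t - e,
    forall s, s != t -> z 0 s <= z' 0 s <= Num.max (z 0 s) (w 0 s)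
    & forall s, (m <= s)%N -> z' 0 s = z 0 s].
Proof.
move=> /feasibleP fz /feasibleP fw tm mT zwm e_gt0 wz.
pose D n := energy P w n - energy P z n.
have D_step s : D s.+1 - D s = w 0 s - z 0 s by rewrite /D !energyS; lra.
have [|||r [r0 rt r_bounds r_step r_end]] := @exchange_path D t m e _ tm _ e_gt0.
- by rewrite /D !energy0 subrr.
- by rewrite subr_ge0.
- have := D_step t; lra.
pose E n := energy P z n + r n.
exists (\row_(s < T) (E s.+1 - E s)); split.
- apply/feasibleP => n nT; rewrite energy_row//; last by rewrite /E energy0 r0 addr0.
  have := r_bounds n; have := fz n nT; have := fw n nT.
  rewrite /E /D.
  case: (lerP 0 (energy P w n - energy P z n)); lra.
- by rewrite mxE /E energyS rt; lra.
- move=> s st; rewrite mxE /E energyS.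
  have := r_step s st; rewrite D_step.
  case: (lerP 0 (w 0 s - z 0 s)); case: (lerP (z 0 s) (w 0 s)); lra.
- by move=> s ms; rewrite mxE /E energyS !r_end ?(leqW ms)//; lra.
Qed.

End Storage.

(** * Pieces of the cost and step lengths *)

Section Greedy.
Context (R : realType) (T : nat) (P : problem R T).
Implicit Types (d x z w : 'rV[R]_T) (t s : 'I_T) (i j : 'I_4) (n m k : nat).
Implicit Types (A : seq ('I_T * 'I_4)) (p q : 'I_T * 'I_4).

Local Notation feasible := (feasible P).
Local Notation a t := (left_derivative (cost P t)).

Definition piece_intercept t i : R :=
  tnth [tuple intercept P (price_up P t) t; intercept P (price_up P t) t;
              intercept P (price_dn P t) t; intercept P (price_dn P t) t] i.

Lemma cost_ge t y i : slope P t i * y + piece_intercept t i <= cost P t y.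
Proof.
rewrite /cost /slope /piece_intercept !le_max.
by case: i => -[|[|[|[|//]]]] ? /=; rewrite lexx ?orbT.
Qed.

Lemma cost_attained t y :
  exists i, cost P t y = slope P t i * y + piece_intercept t i.
Proof.
rewrite /cost; case: leP => _; case: leP => _.
- by exists (@Ordinal 4 3 isT).
- by exists (@Ordinal 4 2 isT).
- by exists (@Ordinal 4 1 isT).
- by exists (@Ordinal 4 0 isT).
Qed.

Let a_piece t := left_derivative_piece (cost_ge t) (cost_attained t).
Let a_mono t := left_derivative_mono (cost_ge t) (cost_attained t).

(** Step 0 itself may be inadmissible, but every negative step is admissible, so the supremum is
    still nonnegative. *)
Lemma piece_step_ge0 d t i :
  (forall y, d 0 t < y -> slope P t i <= a t y) -> (0 <= piece_step P d t i)%E.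
Proof.
move=> supp; apply/lee_addgt0Pr => e e_gt0.
rewrite -leeBlDr// sub0e -EFinN; apply: ereal_sup_ubound; exists (- e) => //=.
by apply: supp; lra.
Qed.

Lemma piece_step_support d t i r : (r%:E <= piece_step P d t i)%E ->
  forall y, d 0 t - r < y -> slope P t i <= a t y.
Proof.
move=> r_le y ry; have : ((d 0 t - y)%:E < piece_step P d t i)%E.
  by apply: lt_le_trans r_le; rewrite lte_fin; lra.
move=> /ereal_sup_gt[_ [r' /= supp <-]]; rewrite lte_fin => h.
by apply: (le_trans supp); apply: a_mono; lra.
Qed.

(** By left continuity, a slope still supported at the end would be supported a little beyond the
    supremum. *)
Lemma piece_step_end d t i r : r%:E = piece_step P d t i ->
  a t (d 0 t - r) < slope P t i.
Proof.
move=> rE; rewrite ltNge; apply/negP => supp.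
have [u u_lt au] :=
  left_derivative_left_continuous (cost_ge t) (cost_attained t) (d 0 t - r).
have : ((d 0 t - u)%:E <= piece_step P d t i)%E.
  apply: ereal_sup_ubound; exists (d 0 t - u) => //=.
  by rewrite opprB addrC subrK (le_trans supp).
rewrite -rE lee_fin; lra.
Qed.

(** * The invariant and its preservation under a decrease *)

Definition frozen x t :=
  forall z, feasible z -> dominated z x -> z 0 t = x 0 t.

(** A feasible path below [x] must rise from [n] to [m] by at least [e_lo] at [m] minus [e_up] at
    [n], which is already at least the rise of [x]. *)
Lemma frozen_between x n m t : (m <= T)%N -> slack_at P x m <= excess_at P x n ->
  (n <= t < m)%N -> frozen x t.
Proof.
move=> mT tight ntm z /feasibleP fz zx.
apply: (energy_sub_tight zx mT _ ntm).
have nT : (n <= T)%N.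
  by case/andP: ntm => nt _; apply: (leq_trans nt); apply: ltnW.
have := fz m mT; have := fz n nT; move: tight; rewrite /slack_at /excess_at; lra.
Qed.

Definition optimum_below x := forall z, feasible z ->
  exists z', [/\ feasible z', dominated z' x & total_cost P z' <= total_cost P z].

(** Here [c] acts as a price: lowering entry [t] saves at least [c] per unit, raising another entry
    costs at most [c] per unit, and the changes sum to zero. As [w] reaches the upper bound at [m],
    the exchange stays before [m], where the slopes are controlled. *)
Lemma optimum_below_decrease x t r w m :
  optimum_below x -> feasible w -> dominated w (decrease x t r) ->
  (t < m)%N -> (m <= T)%N -> energy P w m = e_up P m ->
  forall c, (forall y, x 0 t - r < y -> c <= a t y) ->
  (forall s, (s < m)%N -> frozen x s \/ a s (x 0 s) <= c) ->
  0 <= r -> optimum_below (decrease x t r).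
Proof.
move=> opt fw wx tm mT wm c c_le le_c r_ge0 z0 /opt[z [fz zx z_cost]].
have xE s : decrease x t r 0 s = if s == t then x 0 s - r else x 0 s by rewrite mxE.
have [zt|tz] := lerP (z 0 t) (x 0 t - r).
  by exists z; split=> // s; rewrite xE; case: eqP => [->|].
have := wx t; rewrite xE eqxx => wt.
have zwm : energy P z m <= energy P w m.
  by rewrite wm; have /feasibleP/(_ m mT)/andP[] := fz.
have [||z' [fz' z't z'_between z'_end]] :=
  base_exchange fz fw tm mT zwm (e := z 0 t - (x 0 t - r)); [lra|lra|].
exists z'; split=> //.
  move=> s; rewrite xE; case: eqP => [->|/eqP st]; first by rewrite z't; lra.
  have /andP[_ /le_trans->//] := z'_between s st.
  by rewrite ge_max zx; have := wx s; rewrite xE (negPf st).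
apply: le_trans z_cost; rewrite -subr_le0 /total_cost -sumrB.
apply: (@le_trans _ _ (\sum_s c * (z' 0 s - z 0 s))); last first.
  rewrite -mulr_sumr sumrB.
  have := feasible_total fz; have := feasible_total fz'; rewrite !energyT.
  by move=> /(canRL (addKr _))-> /(canRL (addKr _))->; rewrite subrr mulr0.
apply: ler_sum => s _; have [->|st] := eqVneq s t.
  have : c * (z 0 t - z' 0 t) <= cost P t (z 0 t) - cost P t (z' 0 t).
    apply: (increase_ge_left_derivative (cost_ge t) (cost_attained t) c_le); lra.
  lra.
have /andP[zz' z'm] := z'_between s st.
have [z'z|sz'] := lerP (z' 0 s) (z 0 s).
  have -> : z' 0 s = z 0 s by apply/eqP; rewrite eq_le z'z.
  by rewrite !subrr mulr0.
have sm : (s < m)%N.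
  by rewrite ltnNge; apply/negP => /z'_end z'z; rewrite z'z ltxx in sz'.
have z'x : z' 0 s <= x 0 s.
  apply: le_trans z'm _; rewrite ge_max zx.
  by have := wx s; rewrite xE (negPf st).
have [fr|axc] := le_c s sm; first by have := fr z fz zx; lra.
have := increase_le_left_derivative (cost_ge s) (cost_attained s) zz' z'x.
by nra.
Qed.

Definition steeper : rel ('I_T * 'I_4) :=
  fun p q => slope P q.1 q.2 <= slope P p.1 p.2.

(* inv_support makes the steps of (B) nonnegative.  It is restricted to 1 < T
   because kappa_le is void for T = 1, where price_dn may be negative. *)
Record invariant x A : Prop := Invariant {
  inv_completable : exists2 w, feasible w & dominated w x;
  inv_optimum : optimum_below x;
  inv_removed : forall t i, (t, i) \notin A ->
    frozen x t \/ a t (x 0 t) < slope P t i;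
  inv_sorted : pairwise steeper A;
  inv_support : (1 < T)%N -> forall t i, (t, i) \in A -> slope P t i <= 0 ->
    forall y, x 0 t < y -> slope P t i <= a t y;
  inv_init : dominated x (greedy_init P) }.

Lemma decrease_dominated x t r : 0 <= r -> dominated (decrease x t r) x.
Proof. by move=> r0 s; rewrite mxE; case: eqP => // ->; lra. Qed.

Lemma dominated_trans x z w : dominated x z -> dominated z w -> dominated x w.
Proof. by move=> xz zw s; apply: le_trans (zw s). Qed.

(** A feasible [w] below [x] agrees with [z] at [t], and [x] is squeezed between them. *)
Lemma frozen_dominated x z t : (exists2 w, feasible w & dominated w x) ->
  dominated x z -> frozen z t -> frozen x t.
Proof.
move=> [w fw wx] xz fr u fu ux.
rewrite (fr _ fu (dominated_trans ux xz)); apply/eqP.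
rewrite eq_le xz -(fr _ fw (dominated_trans wx xz)).
by rewrite wx.
Qed.

(** The piece giving the left derivative cannot have been removed for too large a slope. *)
Lemma unfrozen_piece x A t : invariant x A ->
  frozen x t \/ exists2 i, (t, i) \in A & a t (x 0 t) = slope P t i.
Proof.
move=> inv; have [i [aE _ _]] := a_piece t (x 0 t).
have [iA|/(inv_removed inv)] := boolP ((t, i) \in A); first by right; exists i.
by rewrite aE ltxx => -[|//]; left.
Qed.

Lemma invariant_rem x A t i : invariant x A ->
  frozen x t \/ a t (x 0 t) < slope P t i -> invariant x (rem (t, i) A).
Proof.
move=> [cmp opt rmv srt sup ini] ti; split=> //.
- move=> s j sjA; have [[-> ->//]|ne] := (s, j) =P (t, i).
  apply: rmv; apply: contraNN sjA; exact/rem_mem/eqP.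
- by apply: subseq_pairwise srt; exact: rem_subseq.
- by move=> T1 s j /mem_rem; exact: sup.
Qed.

Lemma invariant_remove_times x A (I : pred 'I_T) : invariant x A ->
  (forall s, I s -> frozen x s) -> invariant x (remove_times I A).
Proof.
move=> [cmp opt rmv srt sup ini] frI; split=> //.
- move=> s j; rewrite mem_filter /= negb_and negbK => /orP[/frI|/rmv//]; by left.
- by apply: subseq_pairwise srt; exact: filter_subseq.
- by move=> T1 s j; rewrite mem_filter => /andP[_]; exact: sup.
Qed.

(** Shared by (C), with [m = T], and (B), with [m = tau.+1], where [(t, i)] is steepest only among
    the periods up to [tau]. *)
Lemma invariant_decrease x A t i r m w :
  invariant x A -> 0 <= r -> (r%:E <= piece_step P x t i)%E ->
  (t < m)%N -> (m <= T)%N ->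
  (forall s j, (s < m)%N -> (s, j) \in A -> slope P s j <= slope P t i) ->
  feasible w -> dominated w (decrease x t r) -> energy P w m = e_up P m ->
  invariant (decrease x t r) A.
Proof.
move=> inv r_ge0 /piece_step_support supp tm mT max_slope fw wx wm.
have [cmp opt rmv srt sup ini] := inv.
have cmp' : exists2 w, feasible w & dominated w (decrease x t r) by exists w.
have dec := decrease_dominated x t r_ge0.
split=> //.
- apply: (optimum_below_decrease opt fw wx tm mT wm supp) => // s sm.
  have [fr|[j jA ->]] := unfrozen_piece s inv; first by left.
  by right; exact: max_slope.
- move=> s j /rmv[fr|lt]; [left|right]; first exact: frozen_dominated fr.
  by apply: le_lt_trans lt; apply: a_mono.
- move=> T1 s j sjA sj0 y; rewrite mxE; case: eqP => [st|_]; last exact: sup.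
  rewrite st in sjA * => /supp; apply: le_trans.
  exact: max_slope.
- exact: dominated_trans dec ini.
Qed.

(** * Bounds after a decrease, searches, and sizes of lists *)

Lemma excess_at_decrease x t r n :
  excess_at P (decrease x t r) n = excess_at P x n - (if (t < n)%N then r else 0).
Proof. by rewrite /excess_at energy_decrease addrAC. Qed.

Lemma slack_at_decrease x t r n :
  slack_at P (decrease x t r) n = slack_at P x n - (if (t < n)%N then r else 0).
Proof. by rewrite /slack_at energy_decrease addrAC. Qed.

Lemma first_timeP t0 (Q : pred 'I_T) s : Q s -> Q (first_time t0 Q).
Proof.
move=> Qs; have : s \in [seq s <- enum 'I_T | Q s] by rewrite mem_filter Qs mem_enum.
rewrite /first_time; case E: [seq s <- enum 'I_T | Q s] => [//|s1 l] _ /=.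
by have := mem_head s1 l; rewrite -E mem_filter => /andP[].
Qed.

Lemma last_timeP t0 (Q : pred 'I_T) s : Q s -> Q (last_time t0 Q).
Proof.
move=> Qs; have : s \in [seq s <- enum 'I_T | Q s] by rewrite mem_filter Qs mem_enum.
rewrite /last_time; case E: [seq s <- enum 'I_T | Q s] => [//|s1 l] _ /=.
by have := mem_last s1 l; rewrite -E mem_filter => /andP[].
Qed.

Lemma filter_enum_cons (Q : pred 'I_T) t l :
  [seq s <- enum 'I_T | Q s] = t :: l ->
  Q t /\ forall s, (s < t)%N -> ~~ Q s.
Proof.
move=> E; split.
  by have := mem_head t l; rewrite -E mem_filter => /andP[].
move=> s st; apply/negP => Qs.
have : s \in t :: l by rewrite -E mem_filter Qs mem_enum.
have : sorted (fun u v : 'I_T => (u < v)%N) (t :: l).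
  rewrite -E; apply: sorted_filter; first by move=> ? ? ?; exact: ltn_trans.
  have : sorted ltn [seq val s | s <- enum 'I_T] by rewrite val_enum_ord iota_ltn_sorted.
  by rewrite sorted_map.
rewrite /= (path_sortedE (leT := fun u v : 'I_T => (u < v)%N)); last first.
  by move=> ? ? ?; exact: ltn_trans.
move=> /andP[/allP tl _]; rewrite inE => /predU1P[st_eq|/tl].
  by rewrite st_eq ltnn in st.
by rewrite ltnNge (ltnW st).
Qed.

Lemma filter_steeper A (Q : pred ('I_T * 'I_4)) p l :
  pairwise steeper A -> [seq q <- A | Q q] = p :: l ->
  p \in A /\ Q p /\ forall q, q \in A -> Q q -> slope P q.1 q.2 <= slope P p.1 p.2.
Proof.
move=> srt E; have : p \in [seq q <- A | Q q] by rewrite E mem_head.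
rewrite mem_filter => /andP[Qp pA]; split=> //; split=> // q qA Qq.
have : q \in [seq q <- A | Q q] by rewrite mem_filter Qq.
have : pairwise steeper [seq q <- A | Q q].
  by apply: subseq_pairwise srt; exact: filter_subseq.
rewrite E /= inE => /andP[/allP pl _] /predU1P[->//|/pl].
by [].
Qed.

Lemma size_remove_times (I : pred 'I_T) A p : p \in A -> I p.1 ->
  (size (remove_times I A) < size A)%N.
Proof.
move=> pA Ip; rewrite size_filter -(count_predC (fun q => ~~ I q.1) A).
rewrite -[ltnLHS]addn0 ltn_add2l -has_count; apply/hasP; exists p => //=.
by rewrite negbK.
Qed.

Lemma size_rem_lt A p : p \in A -> (size (rem p A) < size A)%N.
Proof. by move=> pA; rewrite size_rem//; case: A pA. Qed.

Lemma ereal_between (e : \bar R) u : (0 <= e)%E -> (e <= u%:E)%E ->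
  exists r, [/\ e = r%:E, 0 <= r & r <= u].
Proof. by case: e => [r||]//=; rewrite !lee_fin; exists r. Qed.

(** * The descent step (C) *)

Lemma descent_step_correct x A t i :
  invariant x ((t, i) :: A) -> slope P t i <= a t (x 0 t) ->
  exists x' A', [/\ descent_step P x ((t, i) :: A) t i = Continue x' A',
    invariant x' A', dominated x' x & (size A' < size ((t, i) :: A))%N].
Proof.
move=> inv supp; have [w0 fw0 w0x] := inv_completable inv.
have ex_sl n m := completable_excess_slack (n := n) (m := m) fw0 w0x.
rewrite /descent_step; set d1 := piece_step _ _ _ _.
set ms := \big[_/_]_(s < T | _) _; set M := \big[_/_]_(s < T | _) _.
have [s0 /= ts0 msE] : {s0 : 'I_T | (t <= s0)%N & ms = (slack P x s0)%:E}.
  by apply: (eq_bigmin t) => [|s _]; [exact: leqnn|exact: leey].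
have ms_le n : (t < n)%N -> (n <= T)%N -> slack P x s0 <= slack_at P x n.
  case: n => // n tn nT; rewrite -lee_fin -msE.
  exact: (@bigmin_le_cond _ _ _ _ (Ordinal nT)).
have M_ge0 : 0 <= M by exact: bigmax_ge_id.
have M_ge n : (n <= t)%N -> excess_at P x n <= M.
  case: n => [|n] nt; first by rewrite excess_at0.
  have nT := ltn_trans nt (ltn_ord t).
  apply: (le_trans _ (le_bigmax_cond _ _ (j := Ordinal nT) _)) => //.
  by rewrite le_max lexx.
have M_le : M <= slack P x s0.
  apply/bigmax_leP; split=> [|s st].
    by rewrite -(excess_at0 P x); exact: ex_sl.
  rewrite ge_max ex_sl//; last by rewrite ltnS (leq_trans (ltnW st)).
  by rewrite -(excess_at0 P x); exact: ex_sl.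
have d1_ge0 : (0 <= d1)%E.
  apply: piece_step_ge0 => y xy; apply: (le_trans supp); apply: a_mono; exact: ltW.
rewrite msE -EFinB; set d := Order.min _ _.
have [||r [dE r_ge0 r_le]] := @ereal_between d (slack P x s0 - M).
- by rewrite le_min d1_ge0 lee_fin subr_ge0.
- by rewrite ge_min lexx orbT.
have r_d1 : (r%:E <= d1)%E by rewrite -dE ge_min lexx.
rewrite dE /=; set x' := decrease x t r.
(* Only pairs [n <= t < m] lose slack relative to excess, and for them [r <= delta2] is exactly the
   required bound. *)
have [n m nm mT|w [fw wx' _]] := @completion _ _ P x'.
  rewrite excess_at_decrease slack_at_decrease.
  case: (ltnP t n) => tn; first by rewrite (leq_trans tn nm) lerD2r ex_sl.
  case: (ltnP t m) => tm; last by rewrite !subr0 ex_sl.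
  have := M_ge n tn; have := ms_le m tm mT; lra.
have wT : energy P w T = e_up P T.
  by rewrite (feasible_total fw) /e_up eqxx orbT.
have inv' : invariant x' ((t, i) :: A).
  apply: (invariant_decrease inv r_ge0 r_d1 (ltn_ord t) (leqnn T) _ fw wx' wT).
  move=> s j _; rewrite inE => /predU1P[[-> ->]//|].
  by have /= /andP[/allP h _] := inv_sorted inv => /h.
have x'x : dominated x' x by exact: decrease_dominated.
have tA : (t, i) \in (t, i) :: A by exact: mem_head.
case: eqP => [rd1|nd1].
  exists x', (rem (t, i) ((t, i) :: A)); split=> //; last exact: size_rem_lt.
  by apply: invariant_rem => //; right; rewrite mxE eqxx; exact: piece_step_end rd1.
have rE : r = slack P x s0 - M.
  by move: dE; rewrite /d; case: leP => _ dE; [case: nd1|case: dE].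
(* If the minimal slack equals [delta2], the step exhausts it: the slack becomes 0 and is tight
   against the excess 0 at index 0. *)
case: eqP => [[ms_d2]|ms_d2].
  set Q := [pred s : 'I_T | _ && _].
  have /andP[t_last /eqP[sl_last]] : Q (last_time t Q).
    by apply: (last_timeP _ (s := s0)); rewrite /Q /= ts0 -ms_d2 eqxx.
  rewrite -[slack P x _]/(slack_at P x _.+1) in sl_last.
  exists x', (remove_times [pred s : 'I_T | (s <= last_time t Q)%N] ((t, i) :: A)).
  split=> //; last exact: size_remove_times tA t_last.
  apply: invariant_remove_times => // s s_last.
  apply: (frozen_between (n := 0) (m := (last_time t Q).+1)) => //.
  rewrite excess_at0 slack_at_decrease ltnS t_last.
  rewrite sl_last; lra.
set me := \big[_/_]_(s < T | _) _.
(* With [M = 0] the previous case would apply. For positive [M], taking positive parts does not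
   change the maximal excess. *)
have M_gt0 : 0 < M.
  by rewrite lt_neqAle M_ge0 andbT; apply/eqP => M0; apply: ms_d2; rewrite -M0 subr0.
have [s1 s1t s1M] : exists2 s1 : 'I_T, (s1 < t)%N & excess P x s1 = M.
  have /bigmax_geP[|[s1 s1t]] := lexx M; first by rewrite leNgt M_gt0.
  rewrite le_max [M <= 0]leNgt M_gt0 orbF => M_le1; exists s1 => //.
  by apply/eqP; rewrite eq_le M_le1 (M_ge s1.+1).
have meE : me = M%:E.
  apply/eqP; rewrite eq_le; apply/andP; split.
    by apply: bigmax_le => [|s st]; rewrite ?leNye// lee_fin (M_ge s.+1).
  by rewrite -s1M; exact: (le_bigmax_cond _ (fun s => (excess P x s)%:E)).
set Q1 := [pred s : 'I_T | _ && (_ == me)]; set Q2 := [pred s : 'I_T | _ && _].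
have /andP[t1t /eqP ex1] : Q1 (first_time t Q1).
  by apply: (first_timeP _ (s := s1)); rewrite /Q1 /= s1t s1M meE eqxx.
have /andP[tt2 /eqP[sl2]] : Q2 (last_time t Q2).
  by apply: (last_timeP _ (s := s0)); rewrite /Q2 /= ts0 eqxx.
move: ex1; rewrite meE => -[ex1].
set t1 := first_time t Q1 in t1t ex1 *; set t2 := last_time t Q2 in tt2 sl2 *.
exists x', (remove_times [pred s : 'I_T | (t1 < s <= t2)%N] ((t, i) :: A)).
split=> //; last by apply: (size_remove_times tA); rewrite /= t1t.
apply: invariant_remove_times => // s /= s12.
apply: (frozen_between (n := t1.+1) (m := t2.+1)) => //.
rewrite excess_at_decrease slack_at_decrease ltnS tt2 ltnS leqNgt t1t /=.
rewrite -[slack_at P x _]/(slack P x t2) -[excess_at P x _]/(excess P x t1); lra.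
Qed.

(** * The repair step (B) and the termination measure *)

Lemma feasible_of_excess x : (exists2 w, feasible w & dominated w x) ->
  (forall s, excess P x s <= 0) -> feasible x.
Proof.
move=> [w fw wx] ex; apply/feasibleP => n nT.
have := completable_excess_slack fw wx (leq0n n) nT.
have : excess_at P x n <= 0.
  case: n nT => [|n] nT; first by rewrite excess_at0.
  exact: (ex (Ordinal nT)).
rewrite excess_at0 /excess_at /slack_at; lra.
Qed.

(** A single period starts exactly at its upper bound. Hence positive excess implies [1 < T], which
    gives access to [inv_support]. *)
Lemma excess_single_period x t : dominated x (greedy_init P) -> (T <= 1)%N ->
  excess P x t <= 0.
Proof.
move=> /(_ t) + T1; have t0 : t = 0%N :> nat by have := ltn_ord t; lia.
rewrite /excess energyS mxE t0 energy0 /e_lo /=; lra.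
Qed.

(** Second part of the termination measure: a step of length [delta3] keeps the list but clears an
    excess. *)
Definition excess_count x := #|[pred s | 0 < excess P x s]|.

Lemma excess_dominated x z s : dominated x z -> excess P x s <= excess P z s.
Proof.
move=> xz; have := energy_sub_mono P xz (leq0n s.+1) (ltn_ord s).
rewrite !energy0 /excess; lra.
Qed.

Lemma excess_count_dominated x z : dominated x z ->
  (excess_count x <= excess_count z)%N.
Proof.
move=> xz; apply: subset_leq_card; apply/fintype.subsetP => s.
rewrite !inE => /lt_le_trans->//.
exact: excess_dominated.
Qed.

Lemma repair_step_correct x A :
  invariant x A -> (forall p, p \in A -> slope P p.1 p.2 <= 0) -> ~~ feasible x ->
  exists x' A', [/\ repair_step P x A = Continue x' A', invariant x' A'
    & (size A' + excess_count x' < size A + excess_count x)%N].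
Proof.
move=> inv A_npos nfx; have cmp := inv_completable inv; have [w0 fw0 w0x] := cmp.
have ex_sl n m := completable_excess_slack (n := n) (m := m) fw0 w0x.
rewrite /repair_step.
case Etau: [seq j <- enum 'I_T | 0 < excess P x j] => [|tau l].
  case/negP: nfx; apply: feasible_of_excess => // s; rewrite leNgt.
  apply/negP => exs; have : s \in [seq j <- enum 'I_T | 0 < excess P x j].
    by rewrite mem_filter exs mem_enum.
  by rewrite Etau.
have [ex_tau ex_first] := filter_enum_cons Etau.
have ex_le0 n : (n <= tau)%N -> excess_at P x n <= 0.
  case: n => [|n] nt; first by rewrite excess_at0.
  by have := ex_first (Ordinal (ltn_trans nt (ltn_ord tau))) nt; rewrite -leNgt.
have T1 : (1 < T)%N.
  rewrite ltnNge; apply/negP => /(excess_single_period tau (inv_init inv)).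
  by rewrite leNgt ex_tau.
(* The reflected path agrees with [x] before [tau] and is cut to the bound after it, so its entry at
   [tau] is smaller and [tau] is not frozen. *)
have [i tau_A] : exists i, (tau, i) \in A.
  have [fr|[i iA _]] := unfrozen_piece tau inv; last by exists i.
  have [n m|w [fw wx wE]] := @completion _ _ P x; first exact: ex_sl.
  have w_tau0 : energy P w tau = energy P x tau.
    rewrite (wE _ 0%N) ?excess_at0 ?subr0//; exact: ltnW.
  have w_tau1 : energy P w tau.+1 = e_up P tau.+1.
    rewrite (wE _ tau.+1) ?ltn_ord//; first by rewrite /excess_at; lra.
    move=> k; rewrite leq_eqVlt => /predU1P[->//|/ex_le0/le_trans->//].
    exact: ltW ex_tau.
  have := energyS P w tau; have := energyS P x tau; have := fr w fw wx.
  move: ex_tau; rewrite /excess; lra.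
case EA: [seq p : 'I_T * 'I_4 <- A | (p.1 <= tau)%N] => [|[t j] lA].
  have : (tau, i) \in [seq p : 'I_T * 'I_4 <- A | (p.1 <= tau)%N].
    by rewrite mem_filter leqnn.
  by rewrite EA.
have [tA [/= t_tau slope_max]] := filter_steeper (inv_sorted inv) EA.
set d1 := piece_step _ _ _ _; set d2 := \big[_/_]_(s < T | _) _.
have d1_ge0 : (0 <= d1)%E.
  by apply: piece_step_ge0; apply: (inv_support inv) => //; exact: (A_npos _ tA).
have d2_ge0 : (0 <= d2)%E.
  apply: le_bigmin => [|s _]; first exact: leey.
  rewrite lee_fin -(excess_at0 P x); exact: ex_sl.
set d := Order.min _ _.
have [||r [dE r_ge0 r_ex]] := @ereal_between d (excess P x tau).
- by rewrite !le_min d1_ge0 d2_ge0 lee_fin ltW.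
- by rewrite !ge_min lexx !orbT.
have r_d1 : (r%:E <= d1)%E by rewrite -dE ge_min lexx.
have r_d2 n : (t < n)%N -> (n <= tau)%N -> r <= slack_at P x n.
  case: n => // n tn nt; have nT := ltn_trans nt (ltn_ord tau).
  rewrite -lee_fin -dE; apply: (@le_trans _ _ d2); first by rewrite !ge_min lexx orbT.
  by apply: (@bigmin_le_cond _ _ _ _ (Ordinal nT)); rewrite /= -ltnS tn.
rewrite dE /=; set x' := decrease x t r.
(* For [m] beyond [tau], the old slack is at least the excess at [tau], which bounds [r]; up to
   [tau], [delta2] bounds [r]. *)
have [n m nm mT|w [fw wx' wE]] := @completion _ _ P x'.
  rewrite excess_at_decrease slack_at_decrease.
  case: (ltnP t n) => tn; first by rewrite (leq_trans tn nm) lerD2r ex_sl.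
  case: (ltnP t m) => tm; last by rewrite !subr0 ex_sl.
  have := ex_le0 n (leq_trans tn t_tau).
  have [m_tau|tau_m] := leqP m tau; first by have := r_d2 m tm m_tau; lra.
  have := ex_sl tau.+1 m tau_m mT.
  rewrite -[excess_at P x tau.+1]/(excess P x tau); lra.
have ex'_tau : excess P x' tau = excess P x tau - r.
  by rewrite -[LHS]/(excess_at P x' _) excess_at_decrease ltnS t_tau.
(* The excess at [tau] is still nonnegative, hence the largest so far, and the reflected path
   touches the upper bound there. *)
have w_tau : energy P w tau.+1 = e_up P tau.+1.
  rewrite (wE _ tau.+1) ?ltn_ord//; first by rewrite /excess_at; lra.
  move=> k; rewrite leq_eqVlt => /predU1P[->//|k_tau].
  rewrite -[excess_at P x' tau.+1]/(excess P x' tau) ex'_tau excess_at_decrease.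
  have := ex_le0 k k_tau; case: ifP => _; lra.
have inv' : invariant x' A.
  apply: (invariant_decrease inv r_ge0 r_d1 _ (ltn_ord tau) _ fw wx' w_tau) => //.
  by move=> s k s_tau /slope_max; exact.
have x'x : dominated x' x by exact: decrease_dominated.
have cnt := excess_count_dominated x'x.
case: eqP => [rd1|nd1].
  exists x', (rem (t, j) A); split=> //; last first.
    by rewrite -addSn; apply: (leq_add _ cnt); exact: size_rem_lt.
  by apply: invariant_rem => //; right; rewrite mxE eqxx; exact: piece_step_end rd1.
case: eqP => [rd2|nd2].
  set Q := [pred s : 'I_T | _ && _].
  have [s0 /andP[ts0 s0_tau] d2E] : exists2 s0 : 'I_T, (t <= s0 < tau)%N &
      d2 = (slack P x s0)%:E.
    (* An empty range would give [+oo], contrary to the finite step [r]. *)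
    have /bigmin_leP[|[s0 Ps0]] := lexx d2; first by rewrite -/d2 -rd2 leye_eq.
    move=> s0_le; exists s0 => //; apply/eqP; rewrite eq_le s0_le.
    by rewrite andbT; exact: bigmin_le_cond.
  have /andP[/andP[t_last _] /eqP sl_last] : Q (last_time t Q).
    by apply: (last_timeP _ (s := s0)); rewrite /Q /= ts0 s0_tau d2E eqxx.
  exists x', (remove_times [pred s : 'I_T | (s <= last_time t Q)%N] A).
  split=> //; last first.
    by rewrite -addSn; apply: (leq_add _ cnt); exact: size_remove_times tA t_last.
  apply: invariant_remove_times => // s s_last.
  apply: (frozen_between (n := 0) (m := (last_time t Q).+1)) => //.
  rewrite excess_at0 slack_at_decrease ltnS t_last subr_le0.
  by rewrite -lee_fin rd2 -sl_last.
(* The step is [delta3]: the excess at [tau] vanishes and the count drops. *)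
exists x', A; split=> //; rewrite ltn_add2l; apply: proper_card.
rewrite properE; apply/andP; split.
  apply/fintype.subsetP => s; rewrite !inE => /lt_le_trans->//; exact: excess_dominated.
apply/fintype.subsetPn; exists tau; rewrite !inE ?ex_tau// ex'_tau -leNgt subr_le0.
move: dE; rewrite /d; case: (leP d1 _) => _ dE; first by case: nd1.
by move: dE; case: (leP d2 _) => _ dE; [case: nd2|case: dE => ->].
Qed.

(** * Optimality and termination *)

Lemma optimal_below x : optimum_below x -> feasible x -> optimal P x.
Proof.
move=> opt fx; split=> // z /opt[z' [fz' z'x zz']].
by rewrite -(feasible_dominated_eq fx fz' z'x).
Qed.

Lemma greedy_step_correct x A : invariant x A ->
  (exists2 r, greedy_step P x A = Return r & optimal P r) \/
  exists x' A', [/\ greedy_step P x A = Continue x' A', invariant x' A'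
    & (size A' + excess_count x' < size A + excess_count x)%N].
Proof.
move=> inv; have cmp := inv_completable inv; case: A inv => [|[t i] A] inv.
  left; exists x => //; apply: optimal_below; first exact: inv_optimum inv.
  (* With no piece left, every period is frozen, so [x] coincides with the feasible point below
     it. *)
  have [w fw wx] := cmp; suff -> : x = w by [].
  apply/rowP => t; have [fr|[i]//] := unfrozen_piece t inv.
  by rewrite (fr w fw wx).
have tA : (t, i) \in (t, i) :: A by exact: mem_head.
rewrite /greedy_step; case: ltP => [lt|supp].
  right; exists x, (rem (t, i) ((t, i) :: A)); split=> //.
    by apply: invariant_rem => //; right.
  by rewrite ltn_add2r; exact: size_rem_lt.
case: leP => [a_le0|_]; last first.
  right; have [x' [A' [-> inv' x'x sizeA']]] := descent_step_correct inv supp.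
  exists x', A'; split=> //; rewrite -addSn; apply: leq_add => //.
  exact: excess_count_dominated.
have [fx|nfx] := boolP (feasible x).
  by left; exists x => //; apply: optimal_below => //; exact: inv_optimum inv.
(* The head slope is at most the nonpositive left derivative, and sorting passes this bound to the
   whole list. *)
right; apply: repair_step_correct => // p; rewrite inE => /predU1P[->/=|pA].
  exact: le_trans a_le0.
apply: le_trans a_le0; apply: le_trans supp.
by have /= /andP[/allP h _] := inv_sorted inv; exact: (h p).
Qed.

Lemma greedy_returns_optimal x A : invariant x A ->
  (exists r, returns_from P x A r) /\
  (forall r, returns_from P x A r -> optimal P r).
Proof.
move En: (size A + excess_count x)%N => n.
elim/ltn_ind: n x A En => n IH x A En /greedy_step_correct.
move=> [[r0 stepE opt]|[x' [A' [stepE inv' lt]]]].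
  split; first by exists r0; exact: returns_now.
  by move=> r [|x' A']; rewrite stepE // => -[<-].
rewrite En in lt; have [[r0 ret] opt] := IH _ lt _ _ erefl inv'.
split; first by exists r0; exact: returns_later stepE ret.
by move=> r [|x1 A1]; rewrite stepE // => -[<- <-]; exact: opt.
Qed.

(** * The initial state and the conclusion *)

Lemma invariant_init : e_min P <= e_init P <= e_max P -> 0 < eta_ch P ->
  (forall t, (1 < T)%N -> 0 < price_dn P t <= price_up P t) ->
  invariant (greedy_init P) (sorted_pieces P).
Proof.
move=> e_range eta_gt0 price_gt0.
have e_lo_up n m : e_lo P n <= e_up P m.
  by rewrite /e_lo /e_up; case: ifP => _; case: ifP => _; lra.
have init_ge0 t : 0 <= greedy_init P 0 t by rewrite mxE subr_ge0.
have init_dom z : feasible z -> dominated z (greedy_init P).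
  move=> /feasibleP fz t; rewrite mxE.
  have := fz t.+1 (ltn_ord t); have := fz t (ltnW (ltn_ord t)).
  rewrite energyS; lra.
have in_pieces p : p \in sorted_pieces P by rewrite mem_sort mem_enum.
split=> //.
- have f0 : feasible 0.
    apply/feasibleP => n _; rewrite /energy big1 => [|s _]; last by rewrite mxE.
    by rewrite addr0 /e_lo /e_up; case: ifP; rewrite ?lexx.
  by exists 0 => //; exact: init_dom.
- by move=> z fz; exists z; split=> //; exact: init_dom.
- by move=> t i; rewrite in_pieces.
- rewrite -sorted_pairwise; last first.
    by move=> q p s; rewrite /steeper => h1 h2; exact: le_trans h1.
  have srt : sorted (piece_before P) (sorted_pieces P).
    apply: sort_sorted => -[t i] [s j]; rewrite /piece_before /=.
    case: (ltgtP (slope P t i) (slope P s j)) => //= _.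
    case: (ltngtP t s) => [||/val_inj->] /=; rewrite ?orbT// eqxx; exact: leq_total.
  apply: sub_sorted srt => p q; rewrite /piece_before /steeper.
  by case/orP => [/ltW//|/andP[/eqP-> _]].
- move=> T1 t i _ slope_le0 y y_gt.
  apply: (le_trans slope_le0).
  have {}y_gt : 0 < y by apply: le_lt_trans y_gt.
  have [j [-> costE _]] := a_piece t y.
  have /andP[dn_gt0 /(lt_le_trans dn_gt0) up_gt0] := price_gt0 t T1.
  have ch_ge0 l : 0 < l -> 0 <= slope_ch P l by move=> l0; rewrite divr_ge0 ?ltW.
  move: costE; rewrite /slope /piece_intercept.
  case: j => -[|[|[|[|//]]]] ? /= costE; do ?[exact: ch_ge0].
  (* At positive [y], an active discharging piece is at least as steep as the charging piece with
     the same intercept, whose slope is nonnegative. *)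
  + have := cost_ge t y (@Ordinal 4 1 isT); rewrite costE lerD2r ler_pM2r//.
    by apply: le_trans; exact: ch_ge0.
  + have := cost_ge t y (@Ordinal 4 3 isT); rewrite costE lerD2r ler_pM2r//.
    by apply: le_trans; exact: ch_ge0.
Qed.

End Greedy.

Theorem proposition4 (R : realType) (T : nat) (P : problem R T)
  (T_gt0 : (0 < T)%N)
  (cPV_gt0 : 0 < cPV P)
  (cES_ge0 : 0 <= cES P)
  (eta_ch_range : 0 < eta_ch P <= 1)
  (eta_dis_range : 0 < eta_dis P <= 1)
  (price_gt : forall t : 'I_T, cPV P < price P t)
  (kappa_gt0 : 0 < kappa P)
  (kappa_le : forall t t' : 'I_T, t != t' ->
     kappa P <= Num.min (`|price P t - price P t'| / 2) (price P t - cPV P))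
  (e_init_range : e_min P <= e_init P <= e_max P) :
  (exists d : 'rV[R]_T, greedy_returns P d) /\
  (forall d : 'rV[R]_T, greedy_returns P d -> optimal P d).
Proof.
apply: greedy_returns_optimal; apply: invariant_init => //.
  by case/andP: eta_ch_range.
(* The bound on [kappa] is given for pairs of distinct periods, so a second period is produced. *)
move=> t T1; have [s ts] : exists s : 'I_T, t != s.
  pose s := Ordinal T1; have [->|] := eqVneq t s; last by exists s.
  by exists (Ordinal T_gt0).
have := kappa_le t s ts; rewrite le_min => /andP[_ kappa_price].
by rewrite /price_dn /price_up; lra.
Qed.
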